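(* The binary operation $\circledast$ is a t-norm on $\mathbf{L}$ but not a t$_{r}$-norm on $\mathbf{L}$.
   Context: Let $I=[0,1]$ and let $\mathbf{M}$ be the set of all maps $I\to I$; $\wedge,\vee$ denote minimum and maximum of real numbers. A function $f\in\mathbf{M}$ is normal if $\sup\{f(x)\mid x\in I\}=1$, and convex if $f(y)\ge f(x)\wedge f(z)$ whenever $0\le x\le y\le z\le 1$. $\mathbf{L}$ is the set of all normal and convex $f\in\mathbf{M}$. For $B\subseteq I$, $\bm{1}_B$ is the characteristic function of $B$. Let $\mathbf{J}=\{\bm{1}_{\{x\}}\mid x\in I\}$ and $\mathbf{K}=\{\bm{1}_{[a,b]}\mid 0\le a\le b\le 1\}$. For $f,g\in\mathbf{M}$ define $(f\sqcap g)(x)=\sup\{f(y)\wedge g(z)\mid y\wedge z=x\}$, and write $f\sqsubseteq g$ if $f\sqcap g=f$. For $f\in\mathbf{M}$ let $f^{R}(x)=\sup\{f(y)\mid y\ge x\}$. The binary operation $\circledast:\mathbf{L}^2\to\mathbf{M}$ is defined as follows. If $f=\bm{1}_{\{1\}}$, then $f\circledast g=g\circledast f=g$. If $f\ne\bm{1}_{\{1\}}$ and $g\ne\bm{1}_{\{1\}}$, then $$(f\circledast g)(t)=\begin{cases}1, & t\in[0,\xi),\\ f^{R}(\xi)\wedge g^{R}(\xi), & t=\xi,\\ 0, & t\in(\xi,1],\end{cases}$$ where $\xi=\sup\{x\in I\mid f^{R}(x)=1\}\wedge\sup\{x\in I\mid g^{R}(x)=1\}$. A t-norm on $\mathbf{L}$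 is a binary operation $T$ on $\mathbf{L}$ (i.e. with $T(\mathbf{L}^2)\subseteq\mathbf{L}$) such that: (O1) $T(f,g)=T(g,f)$ for all $f,g\in\mathbf{L}$; (O2) $T(T(f,g),h)=T(f,T(g,h))$ for all $f,g,h\in\mathbf{L}$; (O3) $T(f,\bm{1}_{\{1\}})=f$ for all $f\in\mathbf{L}$; (O4) for $f,g,h\in\mathbf{L}$ with $f\sqsubseteq g$, $T(f,h)\sqsubseteq T(g,h)$. A t$_{r}$-norm on $\mathbf{L}$ is a t-norm on $\mathbf{L}$ which in addition satisfies: (O5) $T(\bm{1}_{[0,1]},\bm{1}_{[a,b]})=\bm{1}_{[0,b]}$ for all $0\le a\le b\le 1$; (O6) $T$ is closed on $\mathbf{J}$; (O7) $T$ is closed on $\mathbf{K}$. *)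

(* Defs.v *)
From mathcomp Require Import all_boot all_order all_algebra.
From mathcomp Require Import mathcomp_extra boolp classical_sets set_interval.
From mathcomp Require Import reals interval_inference.

Set Implicit Arguments.
Unset Strict Implicit.
Unset Printing Implicit Defensive.

Import Order.TTheory GRing.Theory Num.Theory.
Local Open Scope classical_set_scope.
Local Open Scope ring_scope.

Section Defs.
Variable R : realType.

Definition I0 : {i01 R} := 0%:i01.
Definition I1 : {i01 R} := 1%:i01.

Lemma sup_num_ge0 (A : set {i01 R}) : 0 <= sup [set x%:num | x in A].
Proof.
have [->|/set0P[x Ax]] := eqVneq A set0; first by rewrite image_set0 sup0.
apply: (@le_trans _ _ x%:num) => //; apply: ub_le_sup; last by exists x.
by exists 1 => _ [y _ <-].
Qed.

Lemma sup_num_le1 (A : set {i01 R}) : sup [set x%:num | x in A] <= 1.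
Proof.
have [->|/set0P[x Ax]] := eqVneq A set0; first by rewrite image_set0 sup0.
by apply: ge_sup => [|_ [y _ <-]//]; exists x%:num, x.
Qed.

(* The supremum of A computed in R, as a point of [0, 1]; it is 0 if A is
   empty. *)
Definition supI (A : set {i01 R}) : {i01 R} :=
  Itv01 (sup_num_ge0 A) (sup_num_le1 A).

Definition M : Type := {i01 R} -> {i01 R}.

Definition normal (f : M) : Prop := supI (range f) = I1.

Definition convex (f : M) : Prop :=
  forall x y z : {i01 R}, x <= y -> y <= z -> Num.min (f x) (f z) <= f y.

Definition L : set M := [set f | normal f /\ convex f].

Definition char (B : set {i01 R}) : M := fun x => if x \in B then I1 else I0.

Definition J : set M := [set char [set x] | x in [set: {i01 R}]].

Definition K : set M :=
  [set f | exists a b : {i01 R}, a <= b /\ f = char `[a, b]].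

Definition meetM (f g : M) : M := fun x =>
  supI [set w | exists y z : {i01 R},
    Num.min y z = x /\ w = Num.min (f y) (g z)].

Definition subM (f g : M) : Prop := meetM f g = f.

Definition upR (f : M) : M := fun x => supI [set f y | y in [set y | x <= y]].

Definition xi (f g : M) : {i01 R} :=
  Num.min (supI [set x | upR f x = I1]) (supI [set x | upR g x = I1]).

(* Total on M; only its values on L are used. *)
Definition circast (f g : M) : M :=
  if `[< f = char [set I1] >] then g
  else if `[< g = char [set I1] >] then f
  else fun t =>
    if t < xi f g then I1
    else if t == xi f g then Num.min (upR f (xi f g)) (upR g (xi f g))
    else I0.

Definition closed_on (T : M -> M -> M) (A : set M) : Prop :=
  forall f g, A f -> A g -> A (T f g).

(* A binary operation on L is given by a map on M of which only the
   restriction to L is constrained. *)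
Record tnorm (T : M -> M -> M) : Prop := {
  tnorm_closed : closed_on T L;
  tnormC : forall f g, L f -> L g -> T f g = T g f;
  tnormA : forall f g h, L f -> L g -> L h -> T (T f g) h = T f (T g h);
  tnorm1 : forall f, L f -> T f (char [set I1]) = f;
  tnorm_mono : forall f g h, L f -> L g -> L h ->
    subM f g -> subM (T f h) (T g h) }.

Record trnorm (T : M -> M -> M) : Prop := {
  trnorm_tnorm : tnorm T;
  trnorm_itv : forall a b : {i01 R}, a <= b ->
    T (char `[I0, I1]) (char `[a, b]) = char `[I0, b];
  trnorm_J : closed_on T J;
  trnorm_K : closed_on T K }.

End Defs.

(* Main.v *)
Require Import Defs.
From mathcomp Require Import all_boot all_order all_algebra.
From mathcomp Require Import boolp classical_sets set_interval.
From mathcomp Require Import reals interval_inference.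

(** Write [f^R] for [upR f]. The function [f^R] is decreasing and, for normal
    [f], starts at [f^R 0 = 1]. Let [trunc f] agree with [f^R] up to the first
    place where [f^R] leaves the value 1, that place included, and vanish
    afterwards. The whole proof rests on one observation ([circast_minM]): away
    from the unit, the operation is the pointwise minimum
    [min (trunc f) (trunc g)]. The number [xi f g] then disappears.

    Commutativity is now obvious. For associativity, the minimum [m] of two
    truncations is decreasing, so [m^R = m], and it drops from 1 to 0 passing
    through at most one other value, so [trunc m = m] ([trunc_minM]); hence both
    bracketings are the minimum of three truncations. Such an [m] satisfies
    [m 0 = 1], so a product of two non-units is never the unit and the case
    distinction in the definition stays consistent.

    For monotonicity, [f] is below [g] iff [min (f^R) g <= f <= g^R]
    pointwise ([subM_charac]). The second half gives [f^R <= g^R], hence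
    [trunc f <= trunc g]; and between decreasing functions the order is the
    pointwise one. If the smaller function is the unit, so is the larger one,
    because the unit is maximal among normal functions; if only the larger one
    is, what remains is that a product of non-units [f] and [h] is below [h],
    which holds since [trunc h <= h^R].

    The operation is not a t_r-norm because it leaves [J]: for [0 < x < 1] the
    square of the characteristic function of [{x}] is that of [[0, x]]. *)

Set Implicit Arguments.
Unset Strict Implicit.
Unset Printing Implicit Defensive.

Import Order.TTheory GRing.Theory Num.Theory.
Local Open Scope classical_set_scope.
Local Open Scope ring_scope.

Section Proof.
Variable R : realType.
Implicit Types (f g h : M R) (x y z s t u : {i01 R}) (A : set {i01 R}).

Local Notation I0 := (I0 R).
Local Notation I1 := (I1 R).

(** * The unit interval as a complete dense chain *)

Lemma le_I1 x : x <= I1.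
Proof. by rewrite -num_le /=. Qed.

Lemma ge_I0 x : I0 <= x.
Proof. by rewrite -num_le /=. Qed.

Lemma I0_neq_I1 : I0 <> I1.
Proof.
by move=> /(congr1 (fun x => x%:num)) /= /eqP; rewrite eq_sym oner_eq0.
Qed.

Lemma eq_I1 x : I1 <= x -> x = I1.
Proof. by move=> x1; apply/le_anti; rewrite le_I1. Qed.

Lemma i01_dense x y : x < y -> exists2 z, x < z & z < y.
Proof.
rewrite -num_lt => xy.
have [xm my] := midf_lt xy.
have m0 : 0 <= (x%:num + y%:num) / 2 by apply: le_trans (ltW xm).
have m1 : (x%:num + y%:num) / 2 <= 1 by apply: le_trans (ltW my) _.
by exists (Itv01 m0 m1); rewrite -num_lt.
Qed.

Lemma le_supI A x : A x -> x <= supI A.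
Proof.
move=> Ax; rewrite -num_le /=; apply: ub_le_sup; last by exists x.
by exists 1 => _ [y _ <-].
Qed.

(** No nonemptiness is required: the supremum of the empty set is the least
    element of the chain. *)
Lemma supI_le A y : (forall x, A x -> x <= y) -> supI A <= y.
Proof.
move=> Ay; rewrite -num_le /=.
have [->|/set0P[x Ax]] := eqVneq A set0; first by rewrite image_set0 sup0.
apply: ge_sup => [|_ [z Az <-]]; first by exists x%:num, x.
by rewrite num_le Ay.
Qed.

Lemma lt_supI A y : y < supI A -> exists2 x, A x & y < x.
Proof.
move=> yA; apply: contrapT => nA; move: yA; apply/negP; rewrite -leNgt.
apply: supI_le => x Ax; rewrite leNgt; apply/negP => yx.
by apply: nA; exists x.
Qed.

(** * The decreasing envelope and the order *)

Lemma le_upR f x y : x <= y -> f y <= upR f x.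
Proof. by move=> xy; apply: le_supI; exists y. Qed.

Lemma upR_le f x u : (forall y, x <= y -> f y <= u) -> upR f x <= u.
Proof. by move=> fu; apply: supI_le => _ [y /= xy <-]; apply: fu. Qed.

Lemma lt_upR f x u : u < upR f x -> exists2 y, x <= y & u < f y.
Proof. by move=> /lt_supI[_ [y /= xy <-] uy]; exists y. Qed.

Lemma upR_nincr f x y : x <= y -> upR f y <= upR f x.
Proof. by move=> xy; apply: upR_le => z /(le_trans xy); apply: le_upR. Qed.

Lemma upR_id f : (forall x y, x <= y -> f y <= f x) -> upR f = f.
Proof.
move=> fd; apply: funext => x; apply/le_anti; rewrite le_upR // andbT.
by apply: upR_le => y; apply: fd.
Qed.

Lemma normal_upR0 f : normal f -> upR f I0 = I1.
Proof.
by move=> <-; congr supI; apply/seteqP; split=> _ [y _ <-]; exists y => //=;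
  apply: ge_I0.
Qed.

(** This unfolds the identity [meetM f g = max (min f g^R) (min f^R g)]: a
    minimum of [y] and [z] equals [x] exactly when one of them is [x] and the
    other is above [x]. *)
Lemma subM_charac f g :
  subM f g <-> forall x, Num.min (upR f x) (g x) <= f x /\ f x <= upR g x.
Proof.
have inmeet x y z : Num.min y z = x ->
    Num.min (f y) (g z) <= meetM f g x.
  by move=> yzx; apply: le_supI; exists y, z.
split=> [fg x|fg].
  split.
    rewrite leNgt lt_min; apply/negP => /andP[/lt_upR[y xy fxy] fxg].
    have /inmeet : Num.min y x = x by apply/min_idPr.
    by rewrite fg leNgt lt_min fxy fxg.
  rewrite -[f in X in X <= _]fg; apply: supI_le => _ [y [z [<- ->]]].
  by rewrite ge_min le_upR ?orbT // ge_min lexx orbT.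
apply: funext => x; have [fgx fx] := fg x.
apply/le_anti/andP; split.
  apply: supI_le => _ [y [z [yzx ->]]].
  have [xy xz] : x <= y /\ x <= z by rewrite -yzx !ge_min !lexx orbT.
  move: yzx; case: (leP y z) => _ yzx; first by rewrite yzx ge_min lexx.
  apply: le_trans fgx; rewrite yzx le_min !ge_min lexx orbT andbT.
  by rewrite le_upR.
rewrite leNgt; apply/negP => mfx.
have [z xz mgz] := lt_upR (lt_le_trans mfx fx).
have /inmeet : Num.min x z = x by apply/min_idPl.
by rewrite leNgt lt_min mfx mgz.
Qed.

Lemma subM_refl f : subM f f.
Proof.
by apply/subM_charac => x; split; [rewrite ge_min lexx orbT|apply: le_upR].
Qed.

Lemma subM_upR f g x : subM f g -> upR f x <= upR g x.
Proof.
move=> /subM_charac fg; apply: upR_le => y xy.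
exact: le_trans (fg y).2 (upR_nincr _ xy).
Qed.

(** * The unit *)

Local Notation e := (char [set I1] : M R).

Lemma charE (B : set {i01 R}) x : B x -> char B x = I1.
Proof. by move=> Bx; rewrite /char mem_set. Qed.

Lemma charNE (B : set {i01 R}) x : ~ B x -> char B x = I0.
Proof. by move=> nBx; rewrite /char memNset. Qed.

Lemma upR_unit x : upR e x = I1.
Proof.
apply: eq_I1; rewrite -[X in X <= _](@charE [set I1] I1) //.
by rewrite le_upR ?le_I1.
Qed.

(** Since [e^R] is constantly 1, being above [e] forces [g <= e]. *)
Lemma unit_maximal g : normal g -> subM e g -> g = e.
Proof.
rewrite subM_charac => gn eg.
have ge x : g x <= e x by case: (eg x); rewrite upR_unit min_r ?le_I1.
apply: funext => x; apply/le_anti; rewrite ge /=.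
have [->|x1] := pselect (x = I1); last by rewrite charNE ?ge_I0.
have {}gn : I1 <= supI (range g) by rewrite gn.
apply: le_trans (le_I1 _) (le_trans gn _).
apply: supI_le => _ [y _ <-].
have [->//|y1] := pselect (y = I1).
by apply: le_trans (ge y) _; rewrite charNE ?ge_I0.
Qed.

(** * Truncation *)

(** Phrasing the cut through the values of [f^R] before [t], and not through
    the supremum of the set where [f^R] is 1, makes monotonicity in [f^R] and
    idempotence direct and confines suprema to the comparison with [xi]. *)
Definition trunc f : M R := fun t =>
  if `[< forall s, s < t -> upR f s = I1 >] then upR f t else I0.

Lemma trunc_le_upR f t : trunc f t <= upR f t.
Proof. by rewrite /trunc; case: asboolP => // _; apply: ge_I0. Qed.

Lemma trunc_after f s t : s < t -> trunc f s <> I1 -> trunc f t = I0.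
Proof.
move=> st fs; rewrite /trunc; case: asboolP => // ft; case: fs.
by rewrite /trunc; case: asboolP => [_|[]]; [apply: ft|
  move=> u us; apply: ft; apply: lt_trans st].
Qed.

Lemma trunc_nincr f s t : s <= t -> trunc f t <= trunc f s.
Proof.
rewrite le_eqVlt => /predU1P[->//|st].
have [->|fs] := pselect (trunc f s = I1); first exact: le_I1.
by rewrite (trunc_after st fs) ge_I0.
Qed.

Lemma trunc_mono f g t :
  (forall x, upR f x <= upR g x) -> trunc f t <= trunc g t.
Proof.
move=> fg; rewrite /trunc; case: asboolP => [f1|_]; last exact: ge_I0.
by case: asboolP => // -[] s /f1 fs; apply: eq_I1; rewrite -fs.
Qed.

Lemma trunc0 f : normal f -> trunc f I0 = I1.
Proof.
move=> /normal_upR0 f0; rewrite /trunc f0; case: asboolP => // -[] s.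
by rewrite ltNge ge_I0.
Qed.

Definition minM f g : M R := fun t => Num.min (f t) (g t).

Lemma minMC f g : minM f g = minM g f.
Proof. by apply: funext => t; apply: minC. Qed.

Lemma minMA f g h : minM (minM f g) h = minM f (minM g h).
Proof. by apply: funext => t; rewrite /minM minA. Qed.

Lemma minM_trunc_nincr f g s t :
  s <= t -> minM (trunc f) (trunc g) t <= minM (trunc f) (trunc g) s.
Proof. by move=> st; rewrite /minM le_min !ge_min !trunc_nincr // orbT. Qed.

Lemma upR_minM f g :
  upR (minM (trunc f) (trunc g)) = minM (trunc f) (trunc g).
Proof. exact: upR_id (@minM_trunc_nincr f g). Qed.

(** If the minimum differs from 1 at some [s < t], one of the two truncations
    does, and that one is already 0 at [t]: the second cut removes nothing. *)
Lemma trunc_minM f g :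
  trunc (minM (trunc f) (trunc g)) = minM (trunc f) (trunc g).
Proof.
apply: funext => t; rewrite {1}/trunc upR_minM; case: asboolP => //.
move=> /existsNP[s /not_implyP[st ms]].
have [fs|fs] := pselect (trunc f s = I1); last first.
  by rewrite /minM (trunc_after st fs) min_l ?ge_I0.
have [gs|gs] := pselect (trunc g s = I1); last first.
  by rewrite /minM (trunc_after st gs) min_r ?ge_I0.
by case: ms; rewrite /minM fs gs minxx.
Qed.

Lemma minM_trunc0 f g : normal f -> normal g ->
  minM (trunc f) (trunc g) I0 = I1.
Proof. by move=> f1 g1; rewrite /minM !trunc0 // minxx. Qed.

Lemma minM_trunc_L f g : normal f -> normal g ->
  L (minM (trunc f) (trunc g)).
Proof.
move=> f1 g1; split.
  apply: eq_I1; rewrite -[X in X <= _](minM_trunc0 f1 g1).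
  by apply: le_supI; exists I0.
by move=> x y z _ yz; rewrite ge_min (minM_trunc_nincr _ _ yz) orbT.
Qed.

(** The unit is told apart by its value at 0. *)
Lemma minM_trunc_neq_unit f g : normal f -> normal g ->
  minM (trunc f) (trunc g) <> e.
Proof.
move=> f1 g1 /(congr1 (fun h => h I0)); rewrite minM_trunc0 // charNE.
  by move=> /esym/I0_neq_I1.
exact: I0_neq_I1.
Qed.

(** * The operation as a minimum of truncations *)

Lemma trunc_lt_xi f t : t < supI [set x | upR f x = I1] -> trunc f t = I1.
Proof.
move=> /lt_supI[x fx tx].
have f1 s : s <= t -> upR f s = I1.
  move=> st; apply: eq_I1; rewrite -[X in X <= _]fx.
  exact/upR_nincr/(le_trans st)/ltW.
by rewrite /trunc; case: asboolP => [_|[] s /ltW]; apply: f1.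
Qed.

Lemma trunc_xi f t : t = supI [set x | upR f x = I1] -> trunc f t = upR f t.
Proof.
move=> tE; rewrite /trunc; case: asboolP => // -[] s.
rewrite tE => /trunc_lt_xi fs; apply: eq_I1; rewrite -[X in X <= _]fs.
exact: trunc_le_upR.
Qed.

(** Density gives a point strictly between the supremum and [t], at which
    [f^R] is no longer 1. *)
Lemma trunc_gt_xi f t : supI [set x | upR f x = I1] < t -> trunc f t = I0.
Proof.
move=> /i01_dense[s xs st]; rewrite /trunc; case: asboolP => // /(_ _ st) fs.
by move: xs; rewrite ltNge le_supI.
Qed.

Lemma trunc_le_xi f t : t <= supI [set x | upR f x = I1] -> trunc f t = upR f t.
Proof.
rewrite le_eqVlt => /predU1P[/trunc_xi//|/trunc_lt_xi ft].
by rewrite ft; apply/esym/eq_I1; rewrite -[X in X <= _]ft trunc_le_upR.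
Qed.

Lemma circast1f f : circast e f = f.
Proof. by rewrite /circast; case: asboolP. Qed.

Lemma circastf1 f : circast f e = f.
Proof. by rewrite /circast; case: asboolP => // _; case: asboolP. Qed.

(** At [t = xi f g] both functions are still at or before their own breaking
    point, where truncation does not change the envelope; beyond it, one of
    them has been cut to 0. *)
Lemma circast_minM f g : f <> e -> g <> e ->
  circast f g = minM (trunc f) (trunc g).
Proof.
move=> fe ge; rewrite /circast; do 2!case: asboolP => // _.
apply: funext => t; rewrite /minM.
case: ltgtP => [||->]; rewrite /xi.
- by rewrite lt_min => /andP[tf tg]; rewrite !trunc_lt_xi // minxx.
- rewrite gt_min => /orP[]/trunc_gt_xi ->; first by rewrite min_l ?ge_I0.
  by rewrite min_r ?ge_I0.
- by rewrite !(@trunc_le_xi _ (Num.min _ _)) // ge_min lexx ?orbT.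
Qed.

Lemma circast_closed f g : L f -> L g -> L (circast f g).
Proof.
move=> Lf Lg.
have [->|fe] := pselect (f = e); first by rewrite circast1f.
have [->|ge] := pselect (g = e); first by rewrite circastf1.
by rewrite circast_minM //; apply: minM_trunc_L; [case: Lf|case: Lg].
Qed.

Lemma circastC f g : circast f g = circast g f.
Proof.
have [->|fe] := pselect (f = e); first by rewrite circast1f circastf1.
have [->|ge] := pselect (g = e); first by rewrite circast1f circastf1.
by rewrite !circast_minM // minMC.
Qed.

Lemma circastA f g h : normal f -> normal g -> normal h ->
  circast (circast f g) h = circast f (circast g h).
Proof.
move=> f1 g1 h1.
have [->|fe] := pselect (f = e); first by rewrite !circast1f.
have [->|ge] := pselect (g = e); first by rewrite circast1f circastf1.
have [->|he] := pselect (h = e); first by rewrite !circastf1.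
rewrite (circast_minM fe ge) (circast_minM ge he).
by rewrite !circast_minM ?trunc_minM ?minMA //; apply: minM_trunc_neq_unit.
Qed.

Lemma circast_mono f g h : normal g ->
  subM f g -> subM (circast f h) (circast g h).
Proof.
move=> g1 fg.
have [->|he] := pselect (h = e); first by rewrite !circastf1.
have [fE|fe] := pselect (f = e).
  move: fg; rewrite fE => /(unit_maximal g1) ->; exact: subM_refl.
rewrite (circast_minM fe he).
have [->|ge] := pselect (g = e).
  rewrite circast1f; apply/subM_charac => x; rewrite upR_minM.
  rewrite ge_min lexx; split=> //.
  by rewrite ge_min trunc_le_upR orbT.
rewrite circast_minM //; apply/subM_charac => x; rewrite !upR_minM.
split; first by rewrite ge_min lexx.
rewrite /minM le_min !ge_min lexx orbT andbT trunc_mono // => y.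
exact: subM_upR.
Qed.

Lemma circast_tnorm : tnorm (@circast R).
Proof.
split.
- exact: circast_closed.
- by move=> f g _ _; apply: circastC.
- by move=> f g h [f1 _] [g1 _] [h1 _]; apply: circastA.
- by move=> f _; apply: circastf1.
- by move=> f g h _ [g1 _] _; apply: circast_mono.
Qed.

(** * The operation does not preserve singletons *)

(** For [0 < x < 1] the square of the characteristic function of [{x}] takes
    the value 1 both at 0 and at [x]. *)
Lemma circast_not_closed_J : ~ closed_on (@circast R) (@J R).
Proof.
have : I0 < I1 by rewrite lt_neqAle le_I1 andbT; apply/eqP/I0_neq_I1.
move=> /i01_dense[x x0 x1] /(_ (char [set x]) (char [set x])).
have up s : s <= x -> upR (char [set x]) s = I1.
  move=> sx; apply: eq_I1; rewrite -[X in X <= _](@charE [set x] x) //.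
  exact: le_upR.
have tr s : s <= x -> trunc (char [set x]) s = I1.
  move=> sx; rewrite /trunc; case: asboolP => [_|[] u us]; apply: up => //.
  exact: le_trans (ltW us) sx.
have xe : char [set x] <> e.
  move=> /(congr1 (fun h => h x)); rewrite charE // charNE.
    by move=> /esym/I0_neq_I1.
  by move=> /= xE; rewrite xE ltxx in x1.
rewrite circast_minM // => -[||a _ aE]; [by exists x|by exists x|].
have at1 s : s <= x -> s = a.
  move=> sx; apply: contrapT => sa.
  have := congr1 (fun h => h s) aE.
  by rewrite /minM !tr // minxx charNE //; apply: I0_neq_I1.
by move: x0; rewrite (at1 x) // (at1 I0) ?ge_I0 // ltxx.
Qed.

End Proof.

Theorem theorem8 (R : realType) :
  tnorm (@circast R) /\ ~ trnorm (@circast R).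
Proof.
split; first exact: circast_tnorm.
by move=> T; apply: (@circast_not_closed_J R); apply: trnorm_J T.
Qed.
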